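(* For $\beta\geq-1/3$ and every integer $n\geq0$, $$\ell_n^{(\beta)}=1+2\sum_{k=1}^n\left|Q_{n+1}^{(\beta)}\bigl(\xi_{k,n+1}^{(\beta)}\bigr)\right|,$$ where the sum is empty when $n=0$, and where $\ell_n^{(\beta)}=\int_{-1}^1\bigl|K_n^{(0,\beta)}(1,t)\bigr|(1+t)^\beta\,dt$ is the value at the endpoint $x=1$ of the $n$th Lebesgue function of the Jacobi series with parameters $(0,\beta)$.
   Context: $P_n^{(\alpha,\beta)}$ is the Jacobi polynomial of degree $n$ normalised by $P_n^{(\alpha,\beta)}(1)=(\alpha+1)_n/n!$. For $\beta>-1$ let $h_j^{(0,\beta)}=\int_{-1}^1 P_j^{(0,\beta)}(t)^2(1+t)^\beta\,dt$ and $$K_n^{(0,\beta)}(x,t)=\sum_{j=0}^n\frac{P_j^{(0,\beta)}(x)P_j^{(0,\beta)}(t)}{h_j^{(0,\beta)}}.$$ For integers $m\geq1$ put $$Q_m^{(\beta)}(x)=2^{-\beta-1}(1+x)^{\beta+1}P_{m-1}^{(0,\beta+1)}(x).$$ On $(-1,1)$ one has $(Q_m^{(\beta)})'(x)=\frac{m+\beta}{2^{\beta+1}}(1+x)^\beta P_{m-1}^{(1,\beta)}(x)$, which has exactly $m-1$ zeros in $(-1,1)$, all simple; they are enumerated from right to left as $$1>\xi_{1,m}^{(\beta)}>\xi_{2,m}^{(\beta)}>\cdots>\xi_{m-1,m}^{(\beta)}>-1.$$ *)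

(* Defs.v *)
From HB Require Import structures.
From mathcomp Require Import all_boot all_order all_algebra.
From mathcomp Require Import finmap.
From mathcomp Require Import all_classical all_reals all_analysis.

Set Implicit Arguments.
Unset Strict Implicit.
Unset Printing Implicit Defensive.

Import Order.TTheory GRing.Theory Num.Theory.
Import numFieldNormedType.Exports.

Local Open Scope classical_set_scope.
Local Open Scope ring_scope.

Definition pochhammer (R : realType) (a : R) (n : nat) : R :=
  \prod_(i < n) (a + i%:R).

(* This is the hypergeometric formula
     (a+1)_n / n! * 2F1(-n, n+a+b+1; a+1; (1-x)/2)
   with (a+1)_n / (a+1)_k rewritten as (a+k+1)_(n-k), so that no denominator
   depends on a. *)
Definition jacobi (R : realType) (a b : R) (n : nat) : {poly R} :=
  \sum_(k < n.+1)
    (pochhammer (n%:R + a + b + 1) k * pochhammer (a + k%:R + 1) (n - k)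
       / (k`!%:R * (n - k)`!%:R)) *: (2^-1 *: ('X - 1)) ^+ k.

Lemma jacobi_at1 (R : realType) (a b : R) (n : nat) :
  (jacobi a b n).[1] = pochhammer (a + 1) n / n`!%:R.
Proof.
rewrite /jacobi horner_sum big_ord_recl big1 => [|i _].
  rewrite /pochhammer big_ord0 subn0 fact0 !mul1r expr0 hornerZ hornerC mulr1.
  by rewrite !addr0.
by rewrite hornerZ horner_exp !hornerE subrr !mulr0 expr0n mulr0.
Qed.

(* For b < 0 the library sets 0 `^ b = 0, so the weight has a finite value at
   the endpoint t = -1; that single point does not affect the integrals. *)
Definition jacobi_norm (R : realType) (b : R) (j : nat) : R :=
  (\int[@lebesgue_measure R]_(t in `[-1, 1])
     ((jacobi 0 b j).[t] ^+ 2 * (1 + t) `^ b))%R.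

Definition jacobi_kernel (R : realType) (b : R) (n : nat) (x t : R) : R :=
  \sum_(j < n.+1) (jacobi 0 b j).[x] * (jacobi 0 b j).[t] / jacobi_norm b j.

Definition lebesgue_function (R : realType) (b : R) (n : nat) (x : R) : R :=
  (\int[@lebesgue_measure R]_(t in `[-1, 1])
     (`|jacobi_kernel b n x t| * (1 + t) `^ b))%R.

Definition jacobiQ (R : realType) (b : R) (m : nat) (x : R) : R :=
  2 `^ (- b - 1) * (1 + x) `^ (b + 1) * (jacobi 0 (b + 1) m.-1).[x].

Definition jacobiQ_critical (R : realType) (b : R) (m : nat) : set R :=
  [set x | -1 < x < 1 /\ derive1 (jacobiQ b m) x = 0].

(* jacobiQ_xi b m k is the k-th critical point, k >= 1, counted from the right.
   fset_set A is the finite set A, and is empty by convention if A is infinite;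
   nth counts from 0. *)
Definition jacobiQ_xi (R : realType) (b : R) (m k : nat) : R :=
  nth 0 (sort (fun x y : R => y <= x) (fset_set (jacobiQ_critical b m))) k.-1.

(* Main.v *)
From HB Require Import structures.
Require Import Defs.
From mathcomp Require Import all_boot all_order all_algebra.
From mathcomp Require Import all_classical all_reals all_analysis.
From mathcomp Require Import finmap measurable_realfun ring lra.

(* With y = (1 + t)/2, the kernel K_n(1, t) is a multiple of
   G(y) = (b + 1) J(y) + y J'(y), where J(y) = P_n^(0,b+1)(2y - 1), so that
   K_n(1, t) (1 + t)^b is the derivative of Q_(n+1) = y^(b+1) J(y).  The value
   at 1 of the Lebesgue function is therefore the total variation of Q_(n+1) on
   [-1, 1].  The n zeros of J split [-1, 1] into n intervals at both ends of
   which Q_(n+1) vanishes, followed by a last one on which it goes from 0 to 1.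
   Rolle gives a critical point in each of the n intervals; as G has degree n
   these are all of them, hence each interval contributes twice the modulus of
   the critical value, and the last one contributes 1. *)

Import Order.TTheory GRing.Theory Num.Theory.
Import numFieldNormedType.Exports.
Local Open Scope classical_set_scope.
Local Open Scope ring_scope.

Set Implicit Arguments.
Unset Strict Implicit.

(** * Pochhammer symbols and the Chu-Vandermonde sum *)

Lemma pochhammerS (R : realType) (a : R) (n : nat) :
  pochhammer a n.+1 = pochhammer a n * (a + n%:R).
Proof. by rewrite /pochhammer big_ord_recr. Qed.

Lemma pochhammerSl (R : realType) (a : R) (n : nat) :
  pochhammer a n.+1 = a * pochhammer (a + 1) n.
Proof.
rewrite /pochhammer big_ord_recl addr0; congr (_ * _).
by apply: eq_bigr => i _; rewrite lift0 -natr1; ring.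
Qed.

Lemma pochhammer_gt0 (R : realType) (a : R) (n : nat) :
  0 < a -> 0 < pochhammer a n.
Proof. by move=> a0; apply: prodr_gt0 => i _; rewrite ltr_wpDr. Qed.

Lemma pochhammer_fact (R : realType) (n k : nat) :
  pochhammer (k%:R + 1) n * k`!%:R = (n + k)`!%:R :> R.
Proof.
elim: n => [|n IH]; first by rewrite /pochhammer big_ord0 mul1r.
rewrite pochhammerS mulrAC IH addSn factS natrM mulrC -natr1 natrD.
by congr (_ * _); ring.
Qed.

(** Pascal's rule splits the sum for [n.+1] into the sum for [n] at [(a, c)] minus [a / c] times the
    one at [(a + 1, c + 1)]; both have the same difference [c - a], hence the same numerator. *)
Lemma chu_vandermonde (R : realType) (n : nat) (a c : R) : 0 < c ->
  \sum_(k < n.+1) (-1) ^+ k * 'C(n, k)%:R * pochhammer a k / pochhammer c k =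
  pochhammer (c - a) n / pochhammer c n.
Proof.
elim: n a c => [|n IH] a c c0.
  by rewrite big_ord1 /pochhammer !big_ord0 expr0 !mul1r.
have c1 : 0 < c + 1 by rewrite ltr_wpDr.
transitivity (\sum_(k < n.+1) (-1) ^+ k * 'C(n, k)%:R * pochhammer a k / pochhammer c k
  - a / c * \sum_(k < n.+1)
     (-1) ^+ k * 'C(n, k)%:R * pochhammer (a + 1) k / pochhammer (c + 1) k).
  rewrite big_ord_recl /=.
  rewrite [in RHS]big_ord_recl /= !bin0 -addrA; congr (_ + _).
  rewrite mulr_sumr -sumrN [X in _ = X + _](_ : _ = \sum_(i < n.+1)
     (-1) ^+ i.+1 * 'C(n, i.+1)%:R * pochhammer a i.+1 / pochhammer c i.+1); last first.
    by rewrite [RHS]big_ord_recr /= bin_small// mulr0 !mul0r addr0.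
  rewrite -big_split; apply: eq_bigr => i _ /=.
  rewrite binS natrD mulrDr 2!mulrDl; congr (_ + _).
  rewrite !pochhammerSl exprS; field.
  by rewrite !gt_eqF// pochhammer_gt0.
rewrite !IH// !pochhammerS.
have -> : c + 1 - (a + 1) = c - a by ring.
have p0 := pochhammer_gt0 n c0.
have cn : 0 < c + n%:R by rewrite ltr_wpDr.
have -> : pochhammer (c + 1) n = pochhammer c n * (c + n%:R) / c.
  by rewrite -pochhammerS pochhammerSl; field; rewrite gt_eqF.
by field; rewrite !gt_eqF.
Qed.

(** * Jacobi polynomials in the shifted variable *)

(* [jacobi 0 b n] as a polynomial in the variable y = (1 + x)/2. *)
Definition sjacobi (R : realType) (b : R) (n : nat) : {poly R} :=
  \sum_(k < n.+1)
    (pochhammer (n%:R + b + 1) k * 'C(n, k)%:R / k`!%:R) *: ('X - 1) ^+ k.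

Lemma horner_jacobi0 (R : realType) (b : R) (n : nat) (x : R) :
  (jacobi 0 b n).[x] = (sjacobi b n).[(1 + x) / 2].
Proof.
rewrite /jacobi /sjacobi !horner_sum; apply: eq_bigr => k _.
rewrite !hornerZ !horner_exp !hornerE.
have -> : 2^-1 * (x - 1) = (1 + x) / 2 - 1 by field.
congr (_ * _); rewrite ?addr0 ?add0r -!mulrA; congr (_ * _).
have kn : (k <= n)%N by rewrite -ltnS.
have f0 (m : nat) : m`!%:R != 0 :> R by rewrite pnatr_eq0 -lt0n fact_gt0.
have /(congr1 (fun m => m%:R : R)) := bin_fact kn; rewrite !natrM => e.
(* Here (k+1)_(n-k) = n!/k!, which produces the binomial coefficient. *)
have := pochhammer_fact R (n - k) k; rewrite subnK// -e mulrA [RHS]mulrAC.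
by move=> /(mulIf (f0 k)) ->; field; rewrite !f0.
Qed.

Lemma coef_sjacobi_max (R : realType) (b : R) (n : nat) :
  (sjacobi b n)`_n = pochhammer (n%:R + b + 1) n / n`!%:R.
Proof.
rewrite /sjacobi big_ord_recr/= coefD coefZ coef_sum big1 => [|i _].
  rewrite add0r binn mulr1 -(polyC1 R).
  have /monicP := monic_exp n (monicXsubC (1 : R)).
  by rewrite lead_coefE size_exp_XsubC => ->; rewrite mulr1.
by rewrite coefZ nth_default ?mulr0// -(polyC1 R) size_exp_XsubC.
Qed.

Lemma size_sjacobi_le (R : realType) (b : R) (n : nat) :
  (size (sjacobi b n) <= n.+1)%N.
Proof.
apply: (leq_trans (size_sum _ _ _)); apply/bigmax_leqP => i _.
apply: (leq_trans (size_scale_leq _ _)).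
by rewrite -(polyC1 R) size_exp_XsubC.
Qed.

Lemma size_sjacobi (R : realType) (b : R) (n : nat) :
  -1 < b -> size (sjacobi b n) = n.+1.
Proof.
move=> b1; apply/eqP; rewrite eqn_leq size_sjacobi_le/= ltnNge.
apply/negP => /leq_sizeP /(_ n (leqnn n)) /eqP.
have n0 : 0 <= n%:R :> R by [].
by rewrite coef_sjacobi_max gt_eqF// divr_gt0 ?ltr0n ?fact_gt0// pochhammer_gt0//; lra.
Qed.

Lemma sjacobi_at1 (R : realType) (b : R) (n : nat) : (sjacobi b n).[1] = 1.
Proof.
rewrite /sjacobi horner_sum big_ord_recl big1 => [|i _].
  rewrite /pochhammer big_ord0 bin0 fact0 !mul1r invr1 scale1r expr0 hornerC.
  by rewrite addr0.
by rewrite hornerZ horner_exp !hornerE subrr expr0n mulr0.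
Qed.

(** Closed form of the kernel sum: with [b + 1] for [b], the right side is K_n(1, t) up to a
    constant, and the left side is y^(-b) times the derivative of y^(b+1) J(y). Both sides are
    compared in powers of y - 1. *)
Lemma sjacobi_shift_sum (R : realType) (b : R) (n : nat) :
  b *: sjacobi b n + 'X * (sjacobi b n)^`() =
  \sum_(j < n.+1) (2 * j%:R + b) *: sjacobi (b - 1) j.
Proof.
pose v : {poly R} := 'X - 1.
pose g n k : R := pochhammer (n%:R + b - 1) k.+1 * 'C(n, k.+1)%:R / k`!%:R.
have f0 (m : nat) : m`!%:R != 0 :> R by rewrite pnatr_eq0 -lt0n fact_gt0.
have k1 (k : nat) : k%:R + 1 != 0 :> R by rewrite natr1 pnatr_eq0.
have dv k : (v ^+ k)^`() = k%:R *: v ^+ k.-1.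
  by rewrite deriv_exp derivB derivX derivC subr0 mul1r scaler_nat.
transitivity (\sum_(k < n.+1) g n.+1 k *: v ^+ k).
  pose c k : R := pochhammer (n%:R + b + 1) k * 'C(n, k)%:R / k`!%:R.
  have cn : c n.+1 = 0 by rewrite /c bin_small// mulr0 mul0r.
  (* Since ['X = v + 1], multiplying the derivative of [v ^+ k] by ['X] feeds the powers [k] and
     [k.-1]. *)
  have -> : 'X * (sjacobi b n)^`() = \sum_(k < n.+1) (c k * k%:R) *: v ^+ k +
                                   \sum_(k < n.+1) (c k.+1 * k.+1%:R) *: v ^+ k.
    rewrite [X in _ = _ + X]big_ord_recr/= cn mul0r scale0r addr0.
    rewrite [X in _ = X + _]big_ord_recl/= mulr0 scale0r add0r -big_split/=.
    rewrite /sjacobi raddf_sum/= big_ord_recl/= derivZ dv scale0r scaler0 add0r mulr_sumr.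
    apply: eq_bigr => k _; rewrite derivZ dv scalerA -scalerDr -scalerAr; congr (_ *: _).
    by rewrite exprS /v; ring.
  rewrite /sjacobi scaler_sumr -!big_split/=; apply: eq_bigr => k _.
  rewrite scalerA -!scalerDl; congr (_ *: _).
  rewrite /g; have -> : n.+1%:R + b - 1 = n%:R + b :> R by rewrite -natr1; ring.
  rewrite pochhammerSl /c pochhammerS factS natrM -natr1 binS natrD.
  have /(congr1 (fun m => m%:R : R)) := mul_bin_left n k.
  rewrite !natrM natrB; last by rewrite -ltnS.
  rewrite -natr1 => e.
  have -> : 'C(n, k.+1)%:R = (n%:R - k%:R) * 'C(n, k)%:R / (k%:R + 1) :> R.
    by rewrite -e; field.
  by field; rewrite f0 k1.
(* The coefficients telescope: [g n.+2 k - g n.+1 k] is the coefficient of the new summand on the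
   right. *)
elim: n {dv} => [|n IH].
  rewrite !big_ord1/= expr0 mulr0 add0r /g/sjacobi big_ord1 /pochhammer big_ord1 big_ord0.
  by rewrite bin0 binn fact0 expr0 !mulr1 invr1 !scalerA /=; congr (_ *: _); ring.
rewrite [RHS]big_ord_recr/= -IH.
have -> : \sum_(k < n.+1) g n.+1 k *: v ^+ k = \sum_(k < n.+2) g n.+1 k *: v ^+ k.
  have gn : g n.+1 n.+1 = 0 by rewrite /g bin_small// mulr0 mul0r.
  by rewrite [RHS]big_ord_recr/= gn scale0r addr0.
rewrite /sjacobi scaler_sumr -big_split/=; apply: eq_bigr => k _.
rewrite scalerA -scalerDl; congr (_ *: _); rewrite /g.
have -> : n.+1%:R + (b - 1) + 1 = n.+1%:R + b :> R by ring.
have -> : n.+2%:R + b - 1 = n.+1%:R + b :> R by rewrite -(natr1 n.+1); ring.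
rewrite pochhammerS pochhammerSl.
have -> : n.+1%:R + b - 1 + 1 = n.+1%:R + b :> R by ring.
have /(congr1 (fun m => m%:R : R)) := mul_bin_left n.+1 k.
rewrite !natrM natrB; last by rewrite -ltnS.
rewrite -(natr1 k) (binS n.+1) natrD => e.
have -> : 'C(n.+1, k.+1)%:R = (n.+1%:R - k%:R) * 'C(n.+1, k)%:R / (k%:R + 1) :> R.
  by rewrite -e; field.
by field; rewrite f0 k1.
Qed.

(** * The fundamental theorem of calculus with singular endpoints *)

(** Two extra points do not affect measurability, so [f] may be singular at the ends, as the weight
    is at -1 for a negative exponent. *)
Lemma measurable_fun_itv_oocc (R : realType) (f : R -> R) (a b : R) :
  (forall x, a < x < b -> {for x, continuous f}) -> measurable_fun `[a, b] f.
Proof.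
move=> cf.
apply/measurable_fun_itv_obnd_cbndP/measurable_fun_itv_bndo_bndcP.
apply: open_continuous_measurable_fun => // x /set_mem /=.
by rewrite in_itv => /cf.
Qed.

(** The open interval is exhausted by compact ones, where the usual theorem applies; monotone
    convergence gives the limit of the integrals, continuity of [F] at the ends that of the
    increments. *)
Lemma ge0_continuous_oo_FTC2 (R : realType) (f F : R -> R) (a b : R) :
  a < b -> {within `[a, b], continuous F} ->
  (forall x, a < x < b -> is_derive x 1 F (f x)) ->
  (forall x, a < x < b -> {for x, continuous f}) ->
  (forall x, a < x < b -> 0 <= f x) ->
  (\int[@lebesgue_measure R]_(x in `[a, b]) (f x)%:E = (F b - F a)%:E)%E.
Proof.
move=> ab /(continuous_within_itvP _ ab)[cF Fa Fb] dF cf f0.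
(* The divisor 3 keeps both margins together shorter than the interval, so that no [I n]
   degenerates. *)
pose e (n : nat) : R := (b - a) / 3 / n.+1%:R.
have ba0 : 0 < b - a by rewrite subr_gt0.
have e0 n : 0 < e n by rewrite !divr_gt0.
have e2 n : e n + e n < b - a.
  suff : e n <= (b - a) / 3 by lra.
  by rewrite ler_pdivrMr// ler_pMr ?divr_gt0// ler1n.
have ecvg : e n @[n --> \oo] --> (0 : R).
  rewrite -(mulr0 ((b - a) / 3)); apply: cvgMr.
  exact: cvg_harmonic.
pose I n := `[a + e n, b - e n]%classic : set R.
have Ioo n : I n `<=` `]a, b[.
  apply: subset_itv; rewrite bnd_simp; first by rewrite ltrDl.
  by rewrite ltrBlDr ltrDl.
have mI i : measurable (I i) by exact: measurable_itv.
have ndI : nondecreasing_seq I.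
  apply/nondecreasing_seqP => n; rewrite subsetEset.
  have en : e n.+1 <= e n.
    by rewrite ler_pM2l ?divr_gt0// lef_pV2 ?posrE// ler_nat.
  by apply: subset_itv; rewrite bnd_simp ?lerD2l ?lerN2.
have bigI : \bigcup_n I n = `]a, b[%classic.
  apply/seteqP; split=> [x [n _ /Ioo]//|x /=].
  rewrite in_itv/= => /andP[ax xb].
  have [n en] : exists n, e n <= Num.min (x - a) (b - x).
    have m0 : 0 < Num.min (x - a) (b - x) by rewrite lt_min !subr_gt0 ax.
    move/cvgrPdist_le : ecvg => /(_ _ m0)[n _ /(_ n (leqnn n))] /=.
    by rewrite sub0r normrN gtr0_norm//; exists n.
  move: en; rewrite le_min => /andP[h1 h2]; exists n => //.
  by rewrite /I/= in_itv/=; apply/andP; split; lra.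
have mf : measurable_fun `[a, b] f by exact: measurable_fun_itv_oocc.
have IE n : (\int[@lebesgue_measure R]_(x in I n) (f x)%:E =
             (F (b - e n) - F (a + e n))%:E)%E.
  rewrite EFinB; apply: continuous_FTC2.
  - by have := e2 n; lra.
  - by apply: continuous_in_subspaceT => x /set_mem /Ioo /= /[!in_itv]; exact: cf.
  - split.
    + move=> x xI; by have [] // := dF x _; apply: (Ioo n); apply: subset_itv_oo_cc.
    + apply: cvg_at_right_filter; apply: cF; apply: (Ioo n).
      by rewrite /I/= in_itv/= lexx/=; have := e2 n; lra.
    + apply: cvg_at_left_filter; apply: cF; apply: (Ioo n).
      by rewrite /I/= in_itv/= lexx/= andbT; have := e2 n; lra.
  - move=> x xI; rewrite derive1E.
    have xF : is_derive x 1 F (f x).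
      by apply: dF; apply: (Ioo n); apply: subset_itv_oo_cc.
    by rewrite derive_val.
have Ic : (\int[@lebesgue_measure R]_(x in I i) (f x)%:E @[i --> \oo] -->
          \int[@lebesgue_measure R]_(x in `]a, b[) (f x)%:E)%E.
  rewrite -bigI; apply: ge0_nondecreasing_set_cvg_integral => //.
    move=> i; apply/measurable_EFinP; apply: measurable_funS mf => //.
    by apply: subset_trans (Ioo i) _; exact: subset_itv_oo_cc.
  by move=> i x /Ioo /=; rewrite in_itv/= lee_fin => /f0.
rewrite -integral_itv_obnd_cbnd; last first.
  apply/measurable_EFinP; apply: measurable_funS mf => //.
  exact: subset_itv_oc_cc.
rewrite -integral_itv_bndo_bndc; last first.
  apply/measurable_EFinP; apply: measurable_funS mf => //.
  exact: subset_itv_oo_cc.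
move/cvg_lim : Ic => <- //; apply/cvg_lim => //.
under eq_fun do rewrite IE.
apply: cvg_EFin; first exact: nearW.
apply: cvgB.
  move/cvg_at_leftP : Fb; apply; split => [n|]; first by rewrite gtrBl.
  rewrite -[X in _ --> X]subr0; apply: cvgB => //; exact: cvg_cst.
move/cvg_at_rightP : Fa; apply; split => [n|]; first by rewrite ltrDl.
rewrite -[X in _ --> X]addr0; apply: cvgD => //; exact: cvg_cst.
Qed.

(** * Moments and orthogonality *)

(* If A = wprim s p, then y^s A(y) is the primitive of y^(s-1) p(y) vanishing at
   0; hence [moment s p] below is the integral of y^(s-1) p(y) over [0, 1]. *)
Definition wprim (R : realType) (s : R) (p : {poly R}) : {poly R} :=
  \poly_(k < size p) (p`_k / (k%:R + s)).

Lemma coef_wprim (R : realType) (s : R) (p : {poly R}) (k : nat) :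
  (wprim s p)`_k = p`_k / (k%:R + s).
Proof.
by rewrite coef_poly; case: ltnP => // pk; rewrite nth_default// mul0r.
Qed.

(** The operator s + y d/dy is diagonal on monomials, which is why [wprim] inverts it
    coefficientwise. *)
Lemma coef_scale_mulX_deriv (R : realType) (s : R) (p : {poly R}) (k : nat) :
  (s *: p + 'X * p^`())`_k = (k%:R + s) * p`_k.
Proof.
rewrite coefD coefZ coefXM coef_deriv mulrDl addrC; congr (_ + _).
by case: k => [|k]; rewrite ?mul0r ?mulr_natl.
Qed.

Lemma wprimK (R : realType) (s : R) (p : {poly R}) : 0 < s ->
  s *: wprim s p + 'X * (wprim s p)^`() = p.
Proof.
move=> s0; apply/polyP => k; rewrite coef_scale_mulX_deriv coef_wprim.
by rewrite mulrC divfK// gt_eqF// ltr_wpDl.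
Qed.

Lemma wprim_is_linear (R : realType) (s : R) : linear (wprim s).
Proof.
by move=> a p q; apply/polyP => k; rewrite !(coefD, coefZ, coef_wprim); ring.
Qed.

HB.instance Definition _ (R : realType) (s : R) :=
  GRing.isLinear.Build R {poly R} {poly R} _ (wprim s) (wprim_is_linear s).

Definition moment (R : realType) (s : R) (p : {poly R}) : R := (wprim s p).[1].

Lemma moment_is_linear (R : realType) (s : R) : scalar (moment s).
Proof. by move=> a p q; rewrite /moment linearP hornerD hornerZ. Qed.

HB.instance Definition _ (R : realType) (s : R) :=
  GRing.isLinear.Build R {poly R} R _ (moment s) (moment_is_linear s).

Lemma momentXn (R : realType) (s : R) (j : nat) :
  moment s 'X^j = (j%:R + s)^-1.
Proof.
rewrite /moment /wprim size_polyXn (_ : \poly_(k < _) _ = (j%:R + s)^-1 *: 'X^j).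
  by rewrite hornerZ hornerXn expr1n mulr1.
apply/polyP => k; rewrite coef_poly coefZ coefXn ltnS.
case: eqVneq => [->|_]; first by rewrite leqnn mulrC.
by rewrite mul0r mulr0; case: ifP.
Qed.

(** Up to sign this is the Beta integral B(s + j, k + 1); the recursion writes one factor y - 1 as a
    difference of two moments. *)
Lemma moment_Xn_subX1 (R : realType) (s : R) (j k : nat) : 0 < s ->
  moment s ('X^j * ('X - 1) ^+ k) =
  (-1) ^+ k * k`!%:R / pochhammer (s + j%:R) k.+1.
Proof.
move=> s0; elim: k j => [|k IH] j.
  by rewrite !expr0 mulr1 momentXn /pochhammer big_ord1 fact0 addr0 !mul1r addrC.
have -> : 'X^j * ('X - 1) ^+ k.+1 =
          'X^(j.+1) * ('X - 1) ^+ k - 'X^j * ('X - 1) ^+ k :> {poly R}.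
  by rewrite !exprS; ring.
rewrite linearB/= !IH.
have sj : 0 < s + j%:R by rewrite ltr_wpDr.
have -> : s + j.+1%:R = s + j%:R + 1 by rewrite -natr1; ring.
have sj1 : 0 < s + j%:R + 1 by rewrite ltr_wpDr.
have p0 := pochhammer_gt0 k sj1.
have sjk : 0 < s + j%:R + 1 + k%:R by rewrite ltr_wpDr.
rewrite 2!(pochhammerSl (s + j%:R)) !pochhammerS factS natrM exprS -natr1.
by field; rewrite !gt_eqF.
Qed.

(** Expansion in powers of y - 1 gives Beta integrals, whose sum is Chu-Vandermonde with a = n + b +
    1 and c = b + j + 2. *)
Lemma moment_sjacobiXn (R : realType) (b : R) (n j : nat) : -1 < b ->
  moment (b + 1) (sjacobi b n * 'X^j) =
  pochhammer (j%:R + 1 - n%:R) n / pochhammer (b + 1 + j%:R) n.+1.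
Proof.
move=> b1; have s0 : 0 < b + 1 by lra.
have sj : 0 < b + 1 + j%:R by rewrite ltr_wpDr.
have sj1 : 0 < b + 1 + j%:R + 1 by rewrite ltr_wpDr.
rewrite /sjacobi mulr_suml linear_sum/= pochhammerSl.
have -> : j%:R + 1 - n%:R = b + 1 + j%:R + 1 - (n%:R + b + 1) by ring.
rewrite invfM mulrCA -chu_vandermonde// mulr_sumr; apply: eq_bigr => k _.
rewrite -scalerAl [('X - 1) ^+ _ * _]mulrC linearZ/= moment_Xn_subX1// pochhammerSl.
have p0 := pochhammer_gt0 k sj1.
by field; rewrite !gt_eqF// ltr0n fact_gt0.
Qed.

Lemma moment_sjacobi_ortho (R : realType) (b : R) (n : nat) (q : {poly R}) :
  -1 < b -> (size q <= n)%N -> moment (b + 1) (sjacobi b n * q) = 0.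
Proof.
move=> b1 qn; rewrite -[q]coefK poly_def mulr_sumr linear_sum/= big1// => j _.
rewrite -scalerAr linearZ/= moment_sjacobiXn//.
have jn : (j < n)%N := leq_trans (ltn_ord j) qn.
(* The Pochhammer factor of index [n - j.+1] is j + 1 - n + (n - j - 1) = 0. *)
have jn' : (n - j.+1 < n)%N by rewrite ltn_subrL (leq_ltn_trans _ jn).
have e : j%:R + 1 - n%:R + (n - j.+1)%:R = 0 :> R by rewrite natrB// -natr1; ring.
by rewrite /pochhammer (bigD1 (Ordinal jn'))//= e !mul0r mulr0.
Qed.

(** One factor is expanded in monomials; orthogonality kills all but the top one. *)
Lemma moment_sjacobi_sqr (R : realType) (b : R) (n : nat) : -1 < b ->
  moment (b + 1) (sjacobi b n ^+ 2) = (2 * n%:R + b + 1)^-1.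
Proof.
move=> b1; have s0 : 0 < b + 1 by lra.
have -> : sjacobi b n ^+ 2 = \sum_(j < n.+1) (sjacobi b n)`_j *: (sjacobi b n * 'X^j).
  rewrite expr2 -{2}[sjacobi b n]coefK poly_def size_sjacobi// mulr_sumr.
  by apply: eq_bigr => j _; rewrite scalerAr.
rewrite linear_sum/= big_ord_recr/= big1 ?add0r => [|j _]; last first.
  by rewrite linearZ/= moment_sjacobi_ortho ?mulr0// size_polyXn.
rewrite linearZ/= moment_sjacobiXn// coef_sjacobi_max.
(* For j = n the numerator is (1)_n = n!, which cancels the factorial in the leading coefficient. *)
have -> : n%:R + 1 - n%:R = 0%:R + 1 :> R by ring.
have := pochhammer_fact R n 0; rewrite fact0 mulr1 addn0 => ->.
have -> : n%:R + b + 1 = b + 1 + n%:R by ring.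
have sn : 0 < b + 1 + n%:R by rewrite ltr_wpDr.
have p0 := pochhammer_gt0 n sn.
have snn : 0 < b + 1 + n%:R + n%:R by rewrite ltr_wpDr.
rewrite pochhammerS; field.
rewrite !gt_eqF// ?ltr0n ?fact_gt0//; lra.
Qed.

(** * Polynomials times a real power *)

(** With y = (1 + x)/2 this is y^s p(y), a form shared by Q, its derivative and the weighted
    integrands. *)
Definition wfun (R : realType) (s : R) (p : {poly R}) (x : R) : R :=
  ((1 + x) / 2) `^ s * p.[(1 + x) / 2].

Lemma is_derive_wfun (R : realType) (s : R) (p : {poly R}) (x : R) : -1 < x ->
  is_derive x 1 (wfun s p)
    (2^-1 * wfun (s - 1) (s *: p + 'X * p^`()) x).
Proof.
move=> x1; set y := (1 + x) / 2.
have y0 : 0 < y by rewrite /y divr_gt0//; lra.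
have dy : is_derive x 1 (fun x : R => (1 + x) / 2) 2^-1.
  apply: is_derive_eq.
  by rewrite !scaler0 !add0r; exact: mulr1.
have dcomp (f : R -> R) (a : R) :
    is_derive y 1 f a -> is_derive x 1 (fun x => f ((1 + x) / 2)) (a * 2^-1).
  by move=> df; exact: (@is_derive1_comp _ f (fun x => (1 + x) / 2)).
have dw := dcomp _ _ (is_derive1_powR s y0).
have dp := dcomp _ _ (is_derive_poly p y).
apply: (is_derive_eq (is_deriveM dw dp)).
rewrite /wfun -/y !hornerE /GRing.scale/=.
have -> : y `^ s = y `^ (s - 1) * y.
  by rewrite -{3}(powRr1 (ltW y0)) -powRD ?subrK// (gt_eqF y0) implybT.
by field.
Qed.

Lemma continuous_wfun_oo (R : realType) (s : R) (p : {poly R}) (x : R) :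
  -1 < x -> {for x, continuous (wfun s p)}.
Proof.
move=> /(is_derive_wfun s p)[dx _].
exact/differentiable_continuous/derivable1_diffP.
Qed.

Lemma wfunN1 (R : realType) (s : R) (p : {poly R}) : 0 < s -> wfun s p (-1) = 0.
Proof. by move=> s0; rewrite /wfun subrr mul0r powR0 ?mul0r// gt_eqF. Qed.

Lemma wfun1 (R : realType) (s : R) (p : {poly R}) : wfun s p 1 = p.[1].
Proof. by rewrite /wfun divff ?powR1 ?mul1r// pnatr_eq0. Qed.

Lemma continuous_wfun (R : realType) (s : R) (p : {poly R}) : 0 < s ->
  {within `[-1, 1], continuous (wfun s p)}.
Proof.
move=> s0; apply/continuous_within_itvP; first lra.
split=> [x| |].
- by rewrite in_itv/= => /andP[x1 _]; exact: continuous_wfun_oo.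
(* At -1 continuity is one-sided and rests on y^s tending to 0 for s > 0. *)
- rewrite wfunN1// -(mul0r p.[(1 + -1) / 2]).
  have cvy : (1 + x) / 2 @[x --> (-1 : R)] --> (1 + -1 : R) / 2.
    by apply: cvgMl; apply: cvgD; [exact: cvg_cst|exact: cvg_id].
  apply: cvgM; last first.
    apply: cvg_at_right_filter.
    apply: (@cvg_comp _ _ _ (fun x : R => (1 + x) / 2) (horner p) _ _ _ cvy).
    exact: continuous_horner.
  apply/cvg_at_rightP => u [u1 ucvg].
  move/cvg_at_rightP : (powR_cvg0 s0) => /(_ (fun n => (1 + u n) / 2)); apply.
  split=> [n|]; first by rewrite divr_gt0//; have := u1 n; lra.
  rewrite -[X in _ --> X](mul0r (2^-1 : R)); apply: cvgMl.
  by rewrite -[X in _ --> X](subrr (1 : R)); apply: cvgD => //; exact: cvg_cst.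
- by apply: cvg_at_left_filter; exact: continuous_wfun_oo.
Qed.

(** * Zeros of the Jacobi polynomials *)

(** The primitive [F] increases from 0 to the moment. If the moment were 0, [F] would vanish
    throughout, so [wprim s p], and with it [p], would be zero. *)
Lemma moment_gt0 (R : realType) (s : R) (p : {poly R}) : 0 < s -> p != 0 ->
  (forall y, 0 < y < 1 -> 0 <= p.[y]) -> 0 < moment s p.
Proof.
move=> s0 p0 pge0; set F := wfun s (wprim s p).
have F1 : F 1 = moment s p by rewrite /F wfun1.
have ndF x y : -1 <= x -> x <= y -> y <= 1 -> F x <= F y.
  apply: ger0_derive1_ndecr; last exact: continuous_wfun.
    move=> z; rewrite in_itv/= => /andP[z1 _].
    by have [] := is_derive_wfun s (wprim s p) z1.
  move=> z; rewrite in_itv/= => /andP[z1 z2].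
  have dF := is_derive_wfun s (wprim s p) z1.
  rewrite derive1E derive_val wprimK// !mulr_ge0 ?powR_ge0//.
  by apply: pge0; lra.
have FN1 : F (-1) = 0 by exact: wfunN1.
have N11 : -1 <= 1 :> R by lra.
have F1ge0 : 0 <= F 1 by rewrite -FN1 ndF.
rewrite -F1 lt_neqAle F1ge0 andbT; apply/negP => /eqP F10.
have A0 y : 0 < y < 1 -> root (wprim s p) y.
  move=> /andP[y0 y1]; have : F (2 * y - 1) = 0.
    have h1 : F (-1) <= F (2 * y - 1) by apply: ndF; lra.
    have h2 : F (2 * y - 1) <= F 1 by apply: ndF; lra.
    by apply/eqP; rewrite eq_le {1}F10 h2 -FN1.
  rewrite /F /wfun.
  have -> : (1 + (2 * y - 1)) / 2 = y by field.
  by move=> /eqP; rewrite mulf_eq0 gt_eqF ?powR_gt0.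
have [A00|A00] := eqVneq (wprim s p) 0.
  by move: p0; rewrite -(wprimK p s0) A00 deriv0 mulr0 scaler0 addr0 eqxx.
(* The points 1/2, 1/3, ... of ]0, 1[ give more roots than the degree allows. *)
pose ys := mkseq (fun k => (k.+2%:R)^-1 : R) (size (wprim s p)).
have := @max_poly_roots _ _ ys A00; rewrite size_mkseq ltnn => H.
apply/notF/H.
  apply/allP => y /mapP[k _ ->]; apply: A0.
  by rewrite invr_gt0 ltr0n/= invf_lt1 ?ltr1n.
rewrite map_inj_uniq ?iota_uniq// => i j /invr_inj /eqP.
by rewrite eqr_nat => /eqP[].
Qed.

Lemma poly_no_root_sign (R : realType) (p : {poly R}) (a b : R) :
  (forall x, a < x < b -> ~~ root p x) ->
  (forall x, a < x < b -> 0 <= p.[x]) \/ (forall x, a < x < b -> p.[x] <= 0).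
Proof.
move=> pr.
have [[x xab x0]|H] := pselect (exists2 x, a < x < b & 0 < p.[x]); last first.
  right=> x xab; rewrite leNgt; apply/negP => x0; apply: H; exists x => //.
left=> y yab; rewrite leNgt; apply/negP => y0.
have [xy|yx] := leP x y.
  have [z zxy] : exists2 z, x <= z <= y & root (- p) z.
    by apply: poly_ivt => //; rewrite !hornerN oppr_le0 oppr_ge0 !ltW.
  by rewrite rootN; apply/negP/pr; lra.
have [z zxy] : exists2 z, y <= z <= x & root p z.
  by apply: poly_ivt; [exact: ltW|rewrite !ltW].
by apply/negP/pr; lra.
Qed.

(* [zs] lists the roots of odd multiplicity in ]a, b[. *)
Lemma poly_sign_changes (R : realType) (p : {poly R}) (a b : R) : p != 0 ->
  exists zs : seq R, [/\ uniq zs, all (fun z => a < z < b) zs, all (root p) zs &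
    let q := p * \prod_(z <- zs) ('X - z%:P) in
    (forall x, a < x < b -> 0 <= q.[x]) \/ (forall x, a < x < b -> q.[x] <= 0)].
Proof.
have [m] := ubnP (size p); elim: m p => // m IH p pm p0.
have [[z zab zp]|H] := pselect (exists2 z, a < z < b & root p z); last first.
  exists [::]; split=> //=; rewrite big_nil mulr1.
  by apply: poly_no_root_sign => x xab; apply/negP => rx; apply: H; exists x.
have /factor_theorem[p1 pE] := zp.
have p10 : p1 != 0 by apply: contraNneq p0 => p10; rewrite pE p10 mul0r.
have sp1 : (size p1 < m)%N.
  by move: pm; rewrite pE size_Mmonic ?monicXsubC// size_XsubC addn2.
have [zs [uzs zsab zsr zss]] := IH p1 sp1 p10.
(* Restoring the factor ['X - z%:P] flips the parity of the multiplicity of [z]: a listed [z] leaves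
   the list, an unlisted one enters it. *)
have [zzs|zzs] := boolP (z \in zs).
  exists (rem z zs); split.
  - exact: rem_uniq.
  - by apply/allP => x /mem_rem; exact: (allP zsab).
  - by apply/allP => x /mem_rem /(allP zsr) /=; rewrite pE rootM => ->.
  - by move: zss; rewrite (big_rem z)//= mulrA -pE.
exists (z :: zs); split=> /=.
- by rewrite zzs.
- by rewrite zab.
- rewrite zp; apply/allP => x /(allP zsr) /=; by rewrite pE rootM => ->.
- rewrite big_cons pE.
  have -> : p1 * ('X - z%:P) * (('X - z%:P) * \prod_(j <- zs) ('X - j%:P)) =
            ('X - z%:P) ^+ 2 * (p1 * \prod_(j <- zs) ('X - j%:P)) by ring.
  case: zss => zss; [left|right] => x /zss q0; rewrite hornerM.
    by rewrite mulr_ge0// horner_exp sqr_ge0.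
  by rewrite mulr_ge0_le0// horner_exp sqr_ge0.
Qed.

(** With fewer than n sign changes, the product of J with the polynomial vanishing at them would
    have constant sign, yet zero moment by orthogonality. *)
Lemma sjacobi_roots (R : realType) (b : R) (n : nat) : -1 < b ->
  exists zs : seq R, [/\ uniq zs, size zs = n, all (fun z => 0 < z < 1) zs &
    all (root (sjacobi b n)) zs].
Proof.
move=> b1; have s0 : 0 < b + 1 by lra.
have szJ := size_sjacobi n b1.
have J0 : sjacobi b n != 0 by rewrite -size_poly_gt0 szJ.
have [zs [uzs zsab zsr zss]] := poly_sign_changes 0 1 J0.
exists zs; split=> //; apply/eqP; rewrite eqn_leq.
rewrite -[(size zs <= n)%N]ltnS -szJ max_poly_roots//= leqNgt.
apply/negP => zsn; set q := \prod_(z <- zs) ('X - z%:P) in zss.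
have mJq : moment (b + 1) (sjacobi b n * q) = 0.
  by apply: moment_sjacobi_ortho => //; rewrite size_prod_XsubC.
have Jq0 : sjacobi b n * q != 0.
  by rewrite mulf_neq0// monic_neq0// monic_prod_XsubC.
case: zss => zss.
  by have := moment_gt0 s0 Jq0 zss; rewrite mJq ltxx.
have Jq0' : - (sjacobi b n * q) != 0 by rewrite oppr_eq0.
have := moment_gt0 s0 Jq0'; rewrite linearN/= mJq oppr0 ltxx => H.
by apply/notF/H => y /zss; rewrite hornerN oppr_ge0.
Qed.

(** * Norms and the kernel at the endpoint *)

Lemma powR_half (R : realType) (s x : R) : -1 <= x ->
  (1 + x) `^ s = 2 `^ s * ((1 + x) / 2) `^ s.
Proof.
by move=> x1; rewrite -powRM ?divr_ge0//; [congr (_ `^ _); field|lra].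
Qed.

Lemma integral_wfun (R : realType) (s : R) (p : {poly R}) : 0 < s ->
  (forall y, 0 < y < 1 -> 0 <= p.[y]) ->
  (\int[@lebesgue_measure R]_(x in `[(-1)%R, 1%R]) (wfun (s - 1) p x)%:E =
   (2 * moment s p)%:E)%E.
Proof.
move=> s0 p0; have N11 : -1 < 1 :> R by lra.
apply: etrans; first apply: (ge0_continuous_oo_FTC2 N11 (F := 2 \*: wfun s (wprim s p))).
- by move=> x; apply: cvgZr; exact: continuous_wfun.
- move=> x /andP[x1 _]; have dF := is_derive_wfun s (wprim s p) x1.
  apply: (is_derive_eq (is_deriveZ 2 dF)).
  by rewrite wprimK// scalerA divff// scale1r.
- by move=> x /andP[x1 _]; exact: continuous_wfun_oo.
- by move=> x x1; rewrite mulr_ge0 ?powR_ge0// p0//; lra.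
- by rewrite /= wfun1 wfunN1// /GRing.scale/= mulr0 subr0.
Qed.

Lemma jacobi_normE (R : realType) (b : R) (j : nat) : -1 < b ->
  jacobi_norm b j = 2 `^ b * 2 / (2 * j%:R + b + 1).
Proof.
move=> b1; have s0 : 0 < b + 1 by lra.
rewrite /jacobi_norm /Rintegral.
rewrite (_ : (\int[_]_(x in _) _ = (2 `^ b)%:E *
    \int[@lebesgue_measure R]_(x in `[(-1)%R, 1%R])
      (wfun (b + 1 - 1) (sjacobi b j ^+ 2) x)%:E)%E).
  rewrite integral_wfun//; last by move=> y _; rewrite horner_exp sqr_ge0.
  by rewrite moment_sjacobi_sqr//= mulrA.
rewrite addrK -ge0_integralZl//.
- apply: eq_integral => x /set_mem/=; rewrite in_itv/= => /andP[x1 _].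
  by rewrite horner_jacobi0 powR_half// /wfun horner_exp -EFinM; congr (_%:E); ring.
- apply/measurable_EFinP; apply: measurable_fun_itv_oocc => x /andP[x1 _].
  exact: continuous_wfun_oo.
- by move=> x _; rewrite lee_fin mulr_ge0 ?powR_ge0// horner_exp sqr_ge0.
Qed.

(** Each P_j is 1 at x = 1 and 1/h_j is proportional to 2j + b + 1, so the kernel is the sum of
    [sjacobi_shift_sum] at [b + 1]. *)
Lemma jacobi_kernel1E (R : realType) (b : R) (n : nat) (t : R) : -1 < b ->
  jacobi_kernel b n 1 t = (2 `^ b * 2)^-1 *
    ((b + 1) *: sjacobi (b + 1) n + 'X * (sjacobi (b + 1) n)^`()).[(1 + t) / 2].
Proof.
move=> b1; rewrite sjacobi_shift_sum horner_sum mulr_sumr addrK.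
apply: eq_bigr => j _.
rewrite hornerZ !horner_jacobi0 jacobi_normE// (_ : (1 + 1) / 2 = 1) ?sjacobi_at1;
  last by field.
rewrite invf_div mul1r addrA; ring.
Qed.

(** * Total variation through critical values *)

(** By the intermediate value theorem [f] keeps one sign, so [F] is monotone and its variation is
    its increment. *)
Lemma integral_norm_derive (R : realType) (F f : R -> R) (a b : R) :
  a < b -> {within `[a, b], continuous F} ->
  (forall x, a < x < b -> is_derive x 1 F (f x)) ->
  (forall x, a < x < b -> {for x, continuous f}) ->
  (forall x, a < x < b -> f x != 0) ->
  (\int[@lebesgue_measure R]_(x in `[a, b]) `|f x|%:E = `|F b - F a|%:E)%E.
Proof.
move=> ab cF dF cf f0.
(* The sign at the midpoint decides; a negative one is reversed by passing to [- F] and [- f]. *)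
wlog [x0 x0ab fx0] : F f cF dF cf f0 / exists2 x0, a < x0 < b & 0 < f x0.
  have mab : a < (a + b) / 2 < b by lra.
  have := f0 _ mab; rewrite neq_lt => /orP[fm|fm] H; last first.
    by apply: H => //; exists ((a + b) / 2).
  transitivity (\int[@lebesgue_measure R]_(x in `[a, b]) `|(- f) x|%:E)%E.
    by apply: eq_integral => x _; rewrite normrN.
  apply: etrans; first apply: (H (- F) (- f)).
  - by move=> x; apply: cvgN; exact: cF.
  - by move=> x /dF dFx; exact: is_deriveN.
  - by move=> x /cf cfx; apply: cvgN; exact: cfx.
  - by move=> x /f0; rewrite oppr_eq0.
  - by exists ((a + b) / 2) => //; rewrite oppr_gt0.
  - by rewrite -opprD normrN.
have fpos x : a < x < b -> 0 < f x.
  move=> xab; rewrite lt_neqAle eq_sym f0//= leNgt; apply/negP => fx.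
  have ivt u v : a < u -> u <= v -> v < b ->
      Num.min (f u) (f v) <= 0 <= Num.max (f u) (f v) -> False.
    move=> au uv vb minmax.
    have cuv : {within `[u, v], continuous f}.
      apply: continuous_in_subspaceT => y /set_mem/=; rewrite in_itv/= => yuv.
      by apply: cf; lra.
    have [c] := IVT uv cuv minmax; rewrite in_itv/= => cuv' /eqP.
    by apply/negP/f0; lra.
  have [xx0|x0x] := leP x x0.
    by apply: (ivt x x0) => //; rewrite ?ge_min ?le_max ?(ltW fx) ?(ltW fx0) ?orbT//; lra.
  by apply: (ivt x0 x) => //; rewrite ?ge_min ?le_max ?(ltW fx) ?(ltW fx0) ?orbT//; lra.
have cfn x : a < x < b -> {for x, continuous (fun x => `|f x|)}.
  by move=> /cf cfx; apply: cvg_norm; exact: cfx.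
have I : (\int[@lebesgue_measure R]_(x in `[a, b]) `|f x|%:E = (F b - F a)%:E)%E.
  apply: (ge0_continuous_oo_FTC2 ab cF) => // x xab.
  by rewrite gtr0_norm ?fpos//; exact: dF.
rewrite I ger0_norm// -lee_fin -I.
by apply: integral_ge0 => x _; rewrite lee_fin.
Qed.

Lemma ge0_integral_itv_split (R : realType) (f : R -> R) (a b c : R) :
  a <= b -> b <= c -> measurable_fun `[a, c] f -> (forall x, 0 <= f x) ->
  (\int[@lebesgue_measure R]_(x in `[a, c]) (f x)%:E =
   \int[@lebesgue_measure R]_(x in `[a, b]) (f x)%:E +
   \int[@lebesgue_measure R]_(x in `[b, c]) (f x)%:E)%E.
Proof.
move=> ab bc mf f0.
have mfW (D : set R) : measurable D -> D `<=` `[a, c] ->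
    measurable_fun D (EFin \o f).
  by move=> mD Dac; apply/measurable_EFinP; apply: measurable_funS mf.
have e : `[a, c]%classic = `[a, b] `|` `]b, c] :> set R.
  by rewrite -itv_bndbnd_setU// bnd_simp.
rewrite -[X in _ = (_ + X)%E]integral_itv_obnd_cbnd; last first.
  apply: mfW; first exact: measurable_itv.
  by apply: subset_itvr; rewrite bnd_simp.
rewrite e ge0_integral_setU//.
- by rewrite -e; apply: mfW; first exact: measurable_itv.
- by move=> x _; rewrite lee_fin.
- apply/disj_set2P/seteqP; split=> // x [] /=.
  by rewrite !in_itv/= => /andP[_ xb] /andP[bx _]; lra.
Qed.

(* Between consecutive zeros of [F], Rolle provides a critical point; if there
   is no other one, [F] is monotone on both sides of it and has variation
   [2 * `|F x|] there. *)
Lemma integral_norm_derive_zeros (R : realType) (F f : R -> R) (zs : seq R)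
    (a b : R) :
  {within `[a, b], continuous F} ->
  (forall x, a < x < b -> is_derive x 1 F (f x)) ->
  (forall x, a < x < b -> {for x, continuous f}) ->
  path <%R a zs -> last a zs <= b -> F a = 0 -> {in zs, forall z, F z = 0} ->
  exists xs : seq R, [/\ size xs = size zs, uniq xs,
    {in xs, forall x, a < x < last a zs /\ f x = 0} &
    (forall x, a < x < last a zs -> f x = 0 -> x \in xs) ->
    (\int[@lebesgue_measure R]_(x in `[a, last a zs]) `|f x|%:E =
     (2 * \sum_(x <- xs) `|F x|)%:E)%E].
Proof.
elim: zs a => [|z zs IH] a cF dF cf /=.
  move=> _ ab Fa _; exists [::]; split=> // _.
  by rewrite big_nil mulr0 set_itv1 integral_set1.
move=> /andP[az zzs] lb Fa Fzs.
have zl : z <= last z zs.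
  move: zzs; rewrite lt_path_sortedE => /andP[/allP H _].
  by have := mem_last z zs; rewrite inE => /predU1P[->//|/H /ltW].
have zb : z <= b := le_trans zl lb.
have Fz : F z = 0 by apply: Fzs; rewrite mem_head.
have cFW u v : a <= u -> v <= b -> {within `[u, v], continuous F}.
  move=> au vb; apply: continuous_subspaceW cF.
  by apply: subset_itv; rewrite bnd_simp.
have [xs [sxs uxs xsP Ixs]] : exists xs : seq R, [/\ size xs = size zs, uniq xs,
    {in xs, forall x, z < x < last z zs /\ f x = 0} &
    (forall x, z < x < last z zs -> f x = 0 -> x \in xs) ->
    (\int[@lebesgue_measure R]_(x in `[z, last z zs]) `|f x|%:E =
     (2 * \sum_(x <- xs) `|F x|)%:E)%E].
  apply: IH => //.
  - by apply: cFW => //; exact: ltW.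
  - by move=> x xzb; apply: dF; lra.
  - by move=> x xzb; apply: cf; lra.
  - by move=> y yzs; apply: Fzs; rewrite inE yzs orbT.
have [|||x] := @Rolle _ F a z az.
- by move=> y; rewrite in_itv/= => yaz; have [|] := dF y; first lra.
- by apply: cFW => //; exact: ltW.
- by rewrite Fa Fz.
rewrite in_itv/= => xaz dx0.
have fx : f x = 0.
  have dfx : is_derive x 1 F (f x) by apply: dF; lra.
  by case: dfx => _ <-; case: dx0.
exists (x :: xs); split=> /=.
- by rewrite sxs.
- by rewrite uxs andbT; apply/negP => /xsP[? _]; lra.
- by move=> y /predU1P[->|/xsP[yz fy]]; split=> //; lra.
move=> H.
(* [H] confines the critical points to [x :: xs], and those of [xs] lie beyond [z]. *)
have only y : a < y < z -> f y = 0 -> y = x.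
  move=> yaz fy; have : y \in x :: xs by apply: H => //; lra.
  by rewrite inE => /predU1P[//|/xsP[? _]]; lra.
have mf u v : a <= u -> v <= b -> measurable_fun `[u, v] (fun x => `|f x|).
  move=> au vb; apply: measurable_fun_itv_oocc => y yuv.
  by apply: cvg_norm; apply: cf; lra.
have ax : a <= x by lra.
have xz : x <= z by lra.
rewrite (ge0_integral_itv_split (ltW az) zl)//; last exact: mf.
rewrite (ge0_integral_itv_split ax xz)//; last exact: mf.
have mono u v : a <= u -> u < v -> v <= z -> x <= u \/ v <= x ->
    (\int[@lebesgue_measure R]_(x in `[u, v]) `|f x|%:E = `|F v - F u|%:E)%E.
  move=> au uv vz xuv; apply: integral_norm_derive => //.
  - by apply: cFW => //; lra.
  - by move=> y yuv; apply: dF; lra.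
  - by move=> y yuv; apply: cf; lra.
  - move=> y yuv; apply/eqP => fy.
    by have : y = x by [apply: only => //; lra]; case: xuv; lra.
rewrite (mono a x) //; [|lra|by right].
rewrite (mono x z) //; [|lra|by left].
rewrite Ixs; last first.
  move=> y yz fy; have : y \in x :: xs by apply: H => //; lra.
  by rewrite inE => /predU1P[yx|//]; lra.
(* As [F] vanishes at [a] and [z], the two monotone pieces contribute the modulus of [F x] each. *)
rewrite Fa Fz subr0 sub0r normrN big_cons -!EFinD; congr (_%:E); ring.
Qed.

(** * The function Q and the Lebesgue function at 1 *)

Lemma jacobiQE (R : realType) (b : R) (n : nat) (x : R) : -1 <= x ->
  jacobiQ b n.+1 x = wfun (b + 1) (sjacobi (b + 1) n) x.
Proof.
move=> x1; rewrite /jacobiQ/= horner_jacobi0 powR_half// !mulrA -powRD.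
  by rewrite (_ : - b - 1 + (b + 1) = 0) ?powRr0 ?mul1r//; ring.
by rewrite pnatr_eq0 implybT.
Qed.

Lemma derive1_jacobiQ (R : realType) (b : R) (n : nat) (x : R) : -1 < x ->
  derive1 (jacobiQ b n.+1) x =
  2^-1 * wfun b ((b + 1) *: sjacobi (b + 1) n + 'X * (sjacobi (b + 1) n)^`()) x.
Proof.
move=> x1; have [_] := is_derive_wfun (b + 1) (sjacobi (b + 1) n) x1.
(* [jacobiQE] covers arguments from -1 on; as x > -1, this is a neighbourhood of x. *)
rewrite addrK derive1E => <-; apply: near_eq_derive => //.
by near=> z; rewrite jacobiQE// ltW//; near: z; exact: lt_nbhsr.
Unshelve. all: by end_near. Qed.

(** The factor 2^b extracted from the weight cancels that of the kernel constant, leaving the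
    modulus of the derivative of Q. *)
Lemma lebesgue_function1E (R : realType) (b : R) (n : nat) : -1 < b ->
  lebesgue_function b n 1 = \int[@lebesgue_measure R]_(x in `[-1, 1])
    `|2^-1 * wfun b ((b + 1) *: sjacobi (b + 1) n +
                     'X * (sjacobi (b + 1) n)^`()) x|.
Proof.
move=> b1; apply: eq_Rintegral => x /set_mem/=; rewrite in_itv/= => /andP[x1 _].
rewrite jacobi_kernel1E// powR_half// /wfun.
have p2 : 0 < 2 `^ b :> R by rewrite powR_gt0.
rewrite !normrM !normfV !normrM (gtr0_norm p2) (ger0_norm (powR_ge0 _ _)).
by rewrite (ger0_norm (ler0n _ 2)); field; rewrite gt_eqF.
Qed.

(** A sum ignores order, so any duplicate-free list of the critical points may replace the
    decreasing enumeration. *)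
Lemma sum_jacobiQ_xi (R : realType) (b : R) (m : nat) (xs : seq R) :
  uniq xs -> jacobiQ_critical b m = [set` xs] ->
  \sum_(1 <= k < (size xs).+1) `|jacobiQ b m (jacobiQ_xi b m k)| =
  \sum_(x <- xs) `|jacobiQ b m x|.
Proof.
move=> uxs crit; set L := sort (fun x y : R => y <= x) (fset_set (jacobiQ_critical b m)).
have pL : perm_eq L xs.
  rewrite perm_sort uniq_perm ?fset_uniq// => x.
  rewrite crit in_fset_set; last exact: finite_seq.
  by apply/idP/idP => [/set_mem|xxs] //; exact: mem_set.
rewrite big_add1/= -(perm_size pL) -(perm_big _ pL)/= [RHS](big_nth 0).
by [].
Qed.

(** * Counting the critical points and conclusion *)

Unset Implicit Arguments.

Theorem lemma5p1 (R : realType) (beta : R) (hbeta : - (1 / 3) <= beta) (n : nat) :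
  lebesgue_function beta n 1
  = 1 + 2 * \sum_(1 <= k < n.+1) `|jacobiQ beta n.+1 (jacobiQ_xi beta n.+1 k)|.
Proof.
have b1 : -1 < beta by lra.
have s0 : 0 < beta + 1 by lra.
have s1 : -1 < beta + 1 by lra.
pose J := sjacobi (beta + 1) n.
pose G : {poly R} := (beta + 1) *: J + 'X * J^`().
pose F := wfun (beta + 1) J.
pose f (x : R) := 2^-1 * wfun beta G x.
have dF (x : R) : -1 < x -> is_derive x 1 F (f x).
  by move=> /(is_derive_wfun (beta + 1) J); rewrite addrK.
have cf (x : R) : -1 < x -> {for x, continuous f}.
  by move=> x1; apply: cvgMr; exact: continuous_wfun_oo.
have cF : {within `[-1, 1], continuous F} by exact: continuous_wfun.
have FN1 : F (-1) = 0 by exact: wfunN1.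
(* The power of y is positive here, so critical points of Q are roots of [G] in the variable y. *)
have f0P (x : R) : -1 < x -> f x = 0 <-> root G ((1 + x) / 2).
  move=> x1; rewrite /f /wfun /root; split=> [/eqP|/eqP ->]; last by rewrite !mulr0.
  by rewrite !mulf_eq0 invr_eq0 pnatr_eq0/= gt_eqF// powR_gt0; lra.
have sJ : size J = n.+1 by exact: size_sjacobi.
have sG : (size G <= n.+1)%N.
  apply/leq_sizeP => k nk; rewrite coef_scale_mulX_deriv nth_default ?mulr0//.
  by rewrite sJ.
(* The coefficient of degree n is n + beta + 1 times the leading one of [J]. *)
have G0 : G != 0.
  apply/eqP => /(congr1 (fun p : {poly R} => p`_n)); rewrite coef0 => /eqP.
  have ns : 0 < n%:R + (beta + 1) by rewrite ltr_wpDl.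
  rewrite coef_scale_mulX_deriv mulf_eq0 (gt_eqF ns)/=.
  have -> : J`_n = lead_coef J by rewrite lead_coefE sJ.
  by rewrite lead_coef_eq0 -size_poly_eq0 sJ.
have [ys [uys sys ys01 ysJ]] := sjacobi_roots n s1.
pose zs := sort <=%R [seq 2 * y - 1 | y <- ys].
have zsP (z : R) : z \in zs -> [/\ -1 < z, z < 1 & F z = 0].
  rewrite mem_sort => /mapP[y yys ->].
  have /andP[y0 y1] := allP ys01 y yys.
  have /eqP Jy := allP ysJ y yys.
  split; [lra|lra|rewrite /F /wfun].
  by rewrite (_ : (1 + (2 * y - 1)) / 2 = y) ?Jy ?mulr0//; field.
have pzs : path <%R (-1) zs.
  rewrite lt_path_sortedE; apply/andP; split.
    by apply/allP => z /zsP[].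
  rewrite lt_sorted_uniq_le sort_uniq sort_le_sorted andbT.
  by rewrite map_inj_uniq// => x y /addIr /mulfI; apply; rewrite pnatr_eq0.
(* For n = 0 there is no zero and [l] is -1, where [F] vanishes as well. *)
pose l := last (-1) zs.
have [l1 Nl Fl] : [/\ l < 1, -1 <= l & F l = 0].
  have := mem_last (-1) zs; rewrite inE => /predU1P[le|/zsP[h1 h2 h3]].
    by rewrite /l le; split=> //; lra.
  by split=> //; exact: ltW.
(* This yields n critical points; the formula [Ixs] becomes available once they are known to be
   all. *)
have [|||||||xs [sxs uxs xsP Ixs]] := @integral_norm_derive_zeros R F f zs (-1) 1.
- exact: cF.
- by move=> x /andP[x1 _]; exact: dF.
- by move=> x /andP[x1 _]; exact: cf.
- exact: pzs.
- exact: ltW.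
- exact: FN1.
- by move=> z /zsP[].
have szxs : size xs = n by rewrite sxs size_sort size_map.
(* One more critical point would give [G], of degree at most n, n + 1 distinct roots. *)
have all_crit (x : R) : -1 < x -> f x = 0 -> x \in xs.
  move=> x1 fx; apply/negPn/negP => xxs.
  pose rs := [seq (1 + z) / 2 | z <- x :: xs].
  have urs : uniq rs by rewrite map_inj_uniq/= ?xxs// => u v; lra.
  have rsG : all (root G) rs.
    apply/allP => _ /mapP[z zxs ->]; move: zxs; rewrite inE => /predU1P[->|/xsP].
      exact/f0P.
    by move=> [/andP[z1 _] fz]; exact/f0P.
  have := max_poly_roots G0 rsG urs.
  by rewrite size_map/= szxs ltnNge sG.
have crit : jacobiQ_critical beta n.+1 = [set` xs].
  apply/seteqP; split=> x /=.
    by move=> [/andP[x1 _]]; rewrite derive1_jacobiQ//; exact: all_crit.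
  move=> xxs; have [/andP[x1 xl] fx] := xsP x xxs.
  by split; [rewrite x1 (lt_trans xl)|rewrite derive1_jacobiQ].
have -> : \sum_(1 <= k < n.+1) `|jacobiQ beta n.+1 (jacobiQ_xi beta n.+1 k)| =
          \sum_(x <- xs) `|F x|.
  rewrite -{1}szxs sum_jacobiQ_xi//; apply: eq_big_seq => x /xsP[/andP[x1 _] _].
  by rewrite jacobiQE// ltW.
have Itot : (\int[@lebesgue_measure R]_(x in `[(-1)%R, 1%R]) `|f x|%:E =
             (1 + 2 * \sum_(x <- xs) `|F x|)%:E)%E.
  rewrite (ge0_integral_itv_split Nl (ltW l1))//; last first.
    apply: measurable_fun_itv_oocc => x /andP[x1 _].
    by apply: cvg_norm; exact: cf.
  rewrite Ixs; last by move=> x /andP[x1 _]; exact: all_crit.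
  (* All critical points lie left of [l], so [F] is monotone from 0 to 1 on the last interval. *)
  have -> : (\int[@lebesgue_measure R]_(x in `[l, 1%R]) `|f x|%:E = `|F 1 - F l|%:E)%E.
    apply: integral_norm_derive => //.
    - by apply: continuous_subspaceW cF; apply: subset_itvr; rewrite bnd_simp.
    - by move=> x /andP[x1 _]; apply: dF; lra.
    - by move=> x /andP[x1 _]; apply: cf; lra.
    - move=> x /andP[x1 _]; apply/eqP => /all_crit xxs.
      have /xsP[/andP[_ xl] _] : x \in xs by apply: xxs; lra.
      by move: xl; rewrite -/l; lra.
  by rewrite Fl subr0 /F wfun1 sjacobi_at1 normr1 -EFinD addrC.
by rewrite lebesgue_function1E// /Rintegral Itot.
Qed.
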